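(* Let $\mathfrak{M}=(\mathcal{M},\rho)$ be a pseudometric space, let $X$ be a two dimensional (real) Banach space with closed unit ball $B_X$, and let $\mathcal{K}(X)$ be the family of all non-empty convex compact subsets of $X$. Let $F:\mathcal{M}\to\mathcal{K}(X)$ be a set-valued mapping such that for every subset $\mathcal{M}'\subset\mathcal{M}$ with $\#\mathcal{M}'\le 4$ the restriction $F|_{\mathcal{M}'}$ has a Lipschitz selection $f_{\mathcal{M}'}:\mathcal{M}'\to X$ with Lipschitz seminorm $\|f_{\mathcal{M}'}\|_{\mathrm{Lip}(\mathcal{M}',X)}\le 1$. Let $\lambda_1>0$, $\lambda_2$ and $\gamma$ be real numbers satisfying $$\lambda_1\ge e(\mathfrak{M},X),\qquad \lambda_2\ge 3\lambda_1,\qquad \gamma\ge \lambda_2\,\frac{(3\lambda_2+\lambda_1)^2}{(\lambda_2-\lambda_1)^2}, \qquad ( * )$$ where $e(\mathfrak{M},X)$ is the Lipschitz extension constant of $X$ with respect to $\mathfrak{M}$. For $x\in\mathcal{M}$ define $$F^{[1]}(x)=\bigcap_{z\in\mathcal{M}}\left[F(z)+\lambda_1\rho(x,z)B_X\right],\qquad F^{[2]}(x)=\bigcap_{z\in\mathcal{M}}\left[F^{[1]}(z)+\lambda_2\rho(x,z)B_X\right].$$ Then $F^{[2]}(x)\neq\emptyset$ for every $x\in\mathcal{M}$, and $$d_H(F^{[2]}(x),F^{[2]}(y))\le\gamma\,\rho(x,y)\quad\text{for every } x,y\in\mathcal{M}.$$ Moreover, if $X$ is a two dimensional Euclidean space,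 the same two conclusions hold when $( * )$ is replaced by the weaker requirements $$\lambda_1\ge e(\mathfrak{M},X),\qquad \lambda_2\ge 3\lambda_1,\qquad \gamma\ge\lambda_2\left\{1+\frac{2\lambda_2}{(\lambda_2^2-\lambda_1^2)^{1/2}}\right\}^2.$$
   Context: A pseudometric space $(\mathcal{M},\rho)$ is a set $\mathcal{M}$ with $\rho:\mathcal{M}\times\mathcal{M}\to[0,+\infty]$ satisfying $\rho(x,x)=0$, $\rho(x,y)=\rho(y,x)$ and $\rho(x,y)\le\rho(x,z)+\rho(z,y)$; $\rho(x,y)=0$ with $x\ne y$ and $\rho(x,y)=+\infty$ are allowed. When $r=+\infty$, $A+rB_X$ means $X$ for $A\neq\emptyset$ (and $\lambda\cdot(+\infty)=+\infty$ for $\lambda>0$). A selection of $F$ on $\mathcal{M}'$ is a map $f:\mathcal{M}'\to X$ with $f(x)\in F(x)$ for all $x\in\mathcal{M}'$. The Lipschitz seminorm is $\|f\|_{\mathrm{Lip}(\mathcal{M},X)}=\inf\{\lambda>0:\|f(x)-f(y)\|\le\lambda\rho(x,y)\ \text{for all } x,y\in\mathcal{M}\}$, and similarly on subsets with the restricted pseudometric. $e(\mathfrak{M},X)$ is the infimum of the constants $\lambda>0$ such that for every $\mathcal{M}'\subset\mathcal{M}$ and every Lipschitz mapping $f:\mathcal{M}'\to X$ there is a Lipschitz extension $\tilde f:\mathcal{M}\to X$ of $f$ with $\|\tilde f\|_{\mathrm{Lip}(\mathcal{M},X)}\le\lambda\|f\|_{\mathrm{Lip}(\mathcal{M}',X)}$.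 The sum of sets is the Minkowski sum, $rB_X$ is the closed ball of radius $r$ centered at $0$, and the Hausdorff distance of non-empty bounded sets is $d_H(A,B)=\inf\{r>0: A+rB_X\supset B \text{ and } B+rB_X\supset A\}$. ''Euclidean'' means the norm is induced by an inner product. *)

(* Defs.v *)
From HB Require Import structures.
From mathcomp Require Import all_boot all_order all_algebra.
From mathcomp Require Import sesquilinear.
From mathcomp Require Import all_classical all_reals all_analysis.

Set Implicit Arguments.
Unset Strict Implicit.
Unset Printing Implicit Defensive.

Import Order.TTheory GRing.Theory Num.Theory.
Import numFieldNormedType.Exports.

Local Open Scope classical_set_scope.
Local Open Scope ring_scope.

Section Pseudometric.
Context {R : realType} {M : Type}.

Definition pseudometric (rho : M -> M -> \bar R) : Prop :=
  [/\ forall x y, (0 <= rho x y)%E,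
      forall x, rho x x = 0%E,
      forall x y, rho x y = rho y x
    & forall x y z, (rho x y <= rho x z + rho z y)%E].

End Pseudometric.

Section Lipschitz.
Context {R : realType} {M : Type} {X : normedModType R}.
Variable rho : M -> M -> \bar R.

(* A map defined on a subset A of M is represented by a total map M -> X of
   which only the values on A matter. The infimum is +oo when there is no
   admissible lambda. In the case rho x y = +oo the constraint is void. *)
Definition lip_seminorm (A : set M) (f : M -> X) : \bar R :=
  ereal_inf [set l%:E | l in [set l : R | 0 < l /\
    forall x y, A x -> A y -> ((`|f x - f y|)%:E <= l%:E * rho x y)%E]].

Definition lipschitz_map (A : set M) (f : M -> X) : Prop :=
  (lip_seminorm A f < +oo)%E.

Definition selection (A : set M) (F : M -> set X) (f : M -> X) : Prop :=
  forall x, A x -> F x (f x).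

End Lipschitz.

Definition lip_ext_const {R : realType} {M : Type} (rho : M -> M -> \bar R)
    (X : normedModType R) : \bar R :=
  ereal_inf [set l%:E | l in [set l : R | 0 < l /\
    forall (A : set M) (f : M -> X), lipschitz_map rho A f ->
      exists g : M -> X,
        [/\ lipschitz_map rho setT g,
            forall x, A x -> g x = f x
          & (lip_seminorm rho setT g <= l%:E * lip_seminorm rho A f)%E]]].

Section SetGeometry.
Context {R : realType} {X : normedModType R}.

Definition minkowski_sum (A B : set X) : set X :=
  [set a + b | a in A & b in B].

(* The set r B_X for r in [0, +oo]: for r = +oo it is all of X. The library's
   closed_ball 0 r is not used: it is empty, rather than {0}, for r = 0. *)
Definition cball (r : \bar R) : set X := [set v | ((`|v|)%:E <= r)%E].

Definition hausdorff_dist (A B : set X) : \bar R :=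
  ereal_inf [set r%:E | r in [set r : R | 0 < r /\
    (B `<=` minkowski_sum A (cball r%:E) /\
     A `<=` minkowski_sum B (cball r%:E))]].

Definition euclidean_norm : Prop :=
  exists ip : {dot X for idfun}, forall x : X, `|x| = Num.sqrt (ip x x).

End SetGeometry.

Arguments euclidean_norm {R} X.

Definition refinement {R : realType} {M : Type} {X : normedModType R}
    (rho : M -> M -> \bar R) (l : R) (F : M -> set X) : M -> set X :=
  fun x => \bigcap_(z in [set: M])
    minkowski_sum (F z) (cball (l%:E * rho x z)%E).

(* Main.v *)
Require Import Defs.
From HB Require Import structures.
From mathcomp Require Import all_boot all_order all_algebra.
From mathcomp Require Import sesquilinear.
From mathcomp Require Import all_classical all_reals all_analysis.
From mathcomp Require Import ring lra.

Set Implicit Arguments.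
Unset Strict Implicit.
Unset Printing Implicit Defensive.

Import Order.TTheory GRing.Theory Num.Theory.
Import numFieldNormedType.Exports.

Local Open Scope classical_set_scope.
Local Open Scope ring_scope.

(** The first refinement at z is an intersection of sets C(z, u), where C(z, u)
    is F(u) thickened by l1 rho(z, u). A selection at four points extends to a
    Lipschitz map g with constant l1 ([component_sel4]; the extension constant
    is an infimum, so g arises as a limit), and g(z) lies in C(z, u) for each of
    the four points u. Everything else follows from this property and Helly's
    theorem.

    Since the plane has Helly number 3, a point v is at distance at most r from
    the intersection of a compact convex family, any three members of which
    meet, as soon as it is at distance at most r from the intersection of any
    two members ([helly_thicken]). Hence the second refinement at x is the
    intersection of the sets T obtained by thickening C(z, u) & C(z, u') by
    l2 rho(x, z), for all z, u, u' ([refine2E]).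

    Nonemptiness: any three of the sets T meet. Their definition involves nine
    points, but every use of Helly's theorem for four sets brings
    down the number of points that a common point must take into account, until
    four remain ([seen2_between]). The condition 3 l1 <= l2 leaves enough room
    for the final choice of the common point on a segment
    ([reach_meet_sorted]).

    Hausdorff distance: for v in the second refinement at x, it suffices to find
    a point near v in any two of the sets T at y. A point of a convex set C near
    v, which is slightly too far from some a, is pulled back into the ball of
    radius l2 r around a by moving it towards a point of C at distance at most
    l1 r from a; this multiplies the distance to v by a factor th
    ([pull_const_normed], [pull_const_euclidean]). Combined with Helly's theorem
    this pulls v into C and a thickened intersection of two sets ([pull_inter]).
    Two such steps give the bound l2 th^2 rho(x, y) ([refine2_lipschitz]). The
    two bounds on gamma are the values of l2 th^2 for a general norm and for a
    Euclidean one. *)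

(** * Helly's theorem in the plane *)

Lemma convex_setE (R : numDomainType) (E : lmodType R) (A : set E) :
  convex_set A <-> forall (t : R) x y, 0 <= t -> t <= 1 -> A x -> A y ->
    A (t *: x + (1 - t) *: y).
Proof.
split=> [cA t x y t0 t1 Ax Ay|cA x y t].
  have t01 : 0 <= t <= 1 by rewrite t0.
  have := cA x y (Itv01 t0 t1); rewrite !inE => /(_ Ax Ay).
  by [].
rewrite !inE => Ax Ay; apply: cA => //.
Qed.

Lemma convex_setI (R : numDomainType) (E : lmodType R) (A B : set E) :
  convex_set A -> convex_set B -> convex_set (A `&` B).
Proof.
move=> /convex_setE cA /convex_setE cB; apply/convex_setE.
by move=> t x y t0 t1 [Ax Bx] [Ay By]; split; [exact: cA|exact: cB].
Qed.

Lemma convex_set_wsum (R : realFieldType) (E : lmodType R) (A : set E)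
    (I : finType) (P : pred I) (c : I -> R) (p : I -> E) :
  convex_set A -> (forall i, P i -> 0 <= c i) -> (forall i, P i -> A (p i)) ->
  0 < \sum_(i | P i) c i ->
  A ((\sum_(i | P i) c i)^-1 *: \sum_(i | P i) c i *: p i).
Proof.
move=> /convex_setE cA c0 Ap; set s := \sum_(i | P i) c i.
set v := \sum_(i | P i) c i *: p i.
pose K (s : R) (v : E) := (s = 0 /\ v = 0) \/ (0 < s /\ A (s^-1 *: v)).
suff : K s v by case=> [[->]|[]//]; rewrite ltxx.
rewrite /s /v; elim/big_ind2: _ => [|v1 s1 v2 s2|i Pi].
- by left.
- move=> [[-> ->]|[s1_gt0 A1]]; first by rewrite !add0r.
  move=> [[-> ->]|[s2_gt0 A2]]; first by rewrite !addr0; right.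
  right; split; first exact: addr_gt0.
  have s12 : 0 < s1 + s2 by exact: addr_gt0.
  have := cA (s1 / (s1 + s2)) _ _ _ _ A1 A2.
  rewrite !scalerA mulrAC divff ?gt_eqF// mul1r.
  have -> : (1 - s1 / (s1 + s2)) / s2 = (s1 + s2)^-1.
    by field; rewrite !gt_eqF.
  rewrite -scalerDr; apply.
  + by rewrite divr_ge0// ltW.
  + by rewrite ler_pdivrMr// mul1r lerDl ltW.
- have := c0 i Pi; rewrite le_eqVlt => /orP[/eqP<-|ci0].
    by left; rewrite scale0r.
  by right; split=> //; rewrite scalerA mulVf ?gt_eqF// scale1r; exact: Ap.
Qed.

(** Appending the coordinate 1 turns affine relations into linear ones, and
    n + 2 vectors of a space of dimension n + 1 are linearly dependent. *)
Lemma affine_dependence (R : fieldType) (n : nat) (E : lmodType R)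
    (dimE : Vector.axiom n E) (p : 'I_n.+2 -> E) :
  exists l : 'I_n.+2 -> R,
    [/\ exists i, l i != 0, \sum_i l i = 0 & \sum_i l i *: p i = 0].
Proof.
case: dimE => v2r lin /bij_inj v2r_inj.
pose V : {linear E -> 'rV[R]_n} :=
  HB.pack v2r (GRing.isLinear.Build _ _ _ _ v2r lin).
pose A : 'M[R]_(n.+2, n + 1) := \matrix_i row_mx (V (p i)) 1%:M.
have : kermx A != 0.
  rewrite kermx_eq0 /row_free neq_ltn; apply/orP; left.
  by rewrite (leq_ltn_trans (rank_leq_col _))// addn1.
move=> /rowV0Pn[u /sub_kermxP /matrixP uA u0].
exists (u 0); split.
- by have /rV0Pn[i ui] := u0; exists i.
- have := uA 0 (rshift n 0); rewrite !mxE => uA0; rewrite -[RHS]uA0.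
  apply: eq_bigr => i _.
  by rewrite mxE row_mxEr mxE mulr1.
- apply: v2r_inj; rewrite -[v2r _]/(V _) -[v2r 0]/(V 0) linear0 linear_sum.
  apply/rowP => j; have := uA 0 (lshift 1 j); rewrite !mxE => uAj.
  rewrite summxE -[RHS]uAj; apply: eq_bigr => i _.
  by rewrite linearZ [in RHS]mxE row_mxEl mxE.
Qed.

(** The Helly number of a space of dimension n is n + 1. Radon's argument: the
    points split according to the sign of their coefficients in an affine
    dependence, and the two groups have a common weighted mean. A set indexed
    in one group contains all points of the other, hence this mean. *)
Lemma helly_radon (R : realFieldType) (n : nat) (E : lmodType R)
    (dimE : Vector.axiom n E) (S : 'I_n.+2 -> set E) :
  (forall i, convex_set (S i)) ->
  (forall i, exists v, forall j, j != i -> S j v) ->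
  exists v, forall i, S i v.
Proof.
move=> cS /boolp.choice[p Sp].
have [l [[k lk] l0 lp0]] := affine_dependence dimE p.
pose L := \sum_(i | 0 < l i) l i.
have LE : \sum_(i | ~~ (0 < l i)) - l i = L.
  apply/eqP; rewrite sumrN eq_sym -addr_eq0; apply/eqP.
  by rewrite -[RHS]l0 [RHS](bigID (fun i => 0 < l i)).
have LpE : \sum_(i | ~~ (0 < l i)) - l i *: p i = \sum_(i | 0 < l i) l i *: p i.
  apply/eqP; under eq_bigr do rewrite scaleNr.
  rewrite sumrN eq_sym -addr_eq0; apply/eqP.
  by rewrite -[RHS]lp0 [RHS](bigID (fun i => 0 < l i)).
have L_gt0 : 0 < L.
  have [lk0|lk0|/eqP] := ltgtP (l k) 0; last by rewrite (negbTE lk).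
  - rewrite -LE (bigD1 k)/=; last by rewrite -leNgt ltW.
    rewrite ltr_wpDr ?oppr_gt0// sumr_ge0// => i /andP[].
    by rewrite -leNgt oppr_ge0.
  - rewrite /L (bigD1 k)//= ltr_wpDr// sumr_ge0// => i /andP[].
    by move=> /ltW.
exists (L^-1 *: \sum_(i | 0 < l i) l i *: p i) => j.
have [lj|lj] := ltP 0 (l j); last first.
  apply: convex_set_wsum => // i li; first exact: ltW.
  by apply: Sp; apply: contraTneq li => <-; rewrite -leNgt.
rewrite -LpE -LE; apply: convex_set_wsum => //; last by rewrite LE.
- by move=> i; rewrite -leNgt oppr_ge0.
- by move=> i li; apply: Sp; apply: contraNneq li => <-.
Qed.

Section PlaneHelly.
Context {R : realFieldType} {E : lmodType R} (dimE : Vector.axiom 2 E).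

Lemma helly4 (A B C D : set E) :
  convex_set A -> convex_set B -> convex_set C -> convex_set D ->
  A `&` B `&` C !=set0 -> A `&` B `&` D !=set0 ->
  A `&` C `&` D !=set0 -> B `&` C `&` D !=set0 ->
  exists v, [/\ A v, B v, C v & D v].
Proof.
move=> cA cB cC cD [d [[Ad Bd] Cd]] [c [[Ac Bc] Dc]] [b [[Ab Cb] Db]].
move=> [a [[Ba Ca] Da]].
pose S (i : 'I_4) : set E := nth setT [:: A; B; C; D] i.
have [||v Sv] := @helly_radon _ _ _ dimE S.
- by case; case=> [|[|[|[|]]]].
- case; case=> [|[|[|[|//]]]] i4; [exists a|exists b|exists c|exists d];
  by case; case=> [|[|[|[|//]]]] ? /eqP //= []; exact: val_inj.
exists v; split; [exact: (Sv (@Ordinal 4 0 isT))|exact: (Sv (@Ordinal 4 1 isT))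
  |exact: (Sv (@Ordinal 4 2 isT))|exact: (Sv (@Ordinal 4 3 isT))].
Qed.

(** The first two sets are merged into their intersection. A triple that
    contains it meets by the statement for four sets. *)
Lemma helly_seq (s : seq (set E)) :
  (forall A, List.In A s -> convex_set A) ->
  (forall A B C, List.In A s -> List.In B s -> List.In C s ->
    A `&` B `&` C !=set0) ->
  exists v, forall A, List.In A s -> A v.
Proof.
have [m] := ubnP (size s); elim: m s => // m IH [|A [|B s]]/=.
- by move=> _ _ _; exists 0.
- move=> _ _ /(_ A A A (or_introl erefl) (or_introl erefl) (or_introl erefl)).
  by move=> [v [_ Av]]; exists v => B [<-|].
move=> sm cs s3; have cA : convex_set A by apply: cs; left.
have cB : convex_set B by apply: cs; right; left.
have cI C : List.In C s -> convex_set C by move=> Cs; apply: cs; right; right.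
have AB2 C D : List.In C s -> List.In D s -> exists v, [/\ A v, B v, C v & D v].
  move=> Cs Ds; apply: helly4 => //; [exact: cI|exact: cI|..];
  by apply: s3; auto.
have [|||v sv] := IH ((A `&` B) :: s).
- by rewrite -ltnS.
- by move=> C [<-|/cI//]; exact: convex_setI.
- have AB : exists v, A v /\ B v.
    have [v [[Av Bv] _]] : A `&` B `&` A !=set0 by apply: s3; auto.
    by exists v.
  have AB1 C : List.In C s -> exists v, [/\ A v, B v & C v].
    by move=> Cs; have [v []] := AB2 _ _ Cs Cs; exists v.
  move=> C1 C2 C3 [<-|C1s] [<-|C2s] [<-|C3s].
  + by have [v [? ?]] := AB; exists v.
  + by have [v []] := AB1 _ C3s; exists v.
  + by have [v []] := AB1 _ C2s; exists v.
  + by have [v []] := AB2 _ _ C2s C3s; exists v.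
  + by have [v []] := AB1 _ C1s; exists v.
  + by have [v []] := AB2 _ _ C1s C3s; exists v.
  + by have [v []] := AB2 _ _ C1s C2s; exists v.
  + by apply: s3; auto.
- have [Av Bv] := sv _ (or_introl erefl).
  by exists v => C [<-|[<-|Cs]]//; apply: sv; right.
Qed.

End PlaneHelly.

(** * Compact convex sets in a finite dimensional normed space *)

(** A linear chart onto coordinates is bounded, and bounded away from 0 on the
    unit sphere of the coordinates. Hence it carries bounded sets to bounded
    sets in both directions. *)
Lemma compact_norm_ball (R : realType) (n : nat) (X : normedModType R)
    (dimX : Vector.axiom n X) (c : X) (r : R) : compact [set v | `|v - c| <= r].
Proof.
case: dimX => v2r lin [r2v v2rK r2vK].
pose V : {linear X -> 'rV[R]_n} :=
  HB.pack v2r (GRing.isLinear.Build _ _ _ _ v2r lin).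
have lin' : linear r2v := @GRing.can2_linear _ _ _ V r2v v2rK r2vK.
pose W : {linear 'rV[R]_n -> X} :=
  HB.pack r2v (GRing.isLinear.Build _ _ _ _ r2v lin').
have Wcont : continuous W.
  have -> : W = (fun w : 'rV[R]_n => \sum_(j < n) w 0 j *: W 'e_j) :> (_ -> _).
    apply/funext => w; rewrite {1}(row_sum_delta w) linear_sum.
    by apply: eq_bigr => j _; rewrite linearZ.
  apply: continuous_big => [|j _ w]; first exact: add_continuous.
  by apply: continuousZr_tmp; exact: coord_continuous.
have [m m_gt0 Wm] : exists2 m : R, 0 < m & forall w, m * `|w| <= `|W w|.
  pose S := [set w : 'rV[R]_n | `|w| = 1].
  have [S0|/set0P/negP/negPn/eqP S0] := pselect (S !=set0); last first.
    exists 1 => // w; have [->|w0] := eqVneq w 0; first by rewrite normr0 mulr0.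
    suff : S (`|w|^-1 *: w) by rewrite S0.
    by rewrite /S/= normrZ normfV normr_id mulVf// normr_eq0.
  have cptS : compact S.
    apply: bounded_closed_compact.
      by exists 1; split=> // N N1 w /= ->; exact: ltW.
    rewrite (_ : S = (fun w : 'rV[R]_n => `|w|) @^-1` [set x | x = 1])//.
    apply: closed_comp; last exact: closed_eq.
    by move=> w _; exact: norm_continuous.
  have Ncont : {within S, continuous (fun w => `|W w|)}.
    apply: continuous_subspaceT => w.
    by apply: continuous_comp; [exact: Wcont|exact: norm_continuous].
  have [u /[!inE] Su umin] := compact_EVT_min S0 cptS Ncont.
  exists `|W u|.
    rewrite normr_gt0; apply/eqP => Wu0.
    have u0 : u = 0 by rewrite -[u]r2vK -[r2v u]/(W u) Wu0 -[v2r 0]/(V 0) linear0.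
    by move: Su; rewrite /S/= u0 normr0 => /esym/eqP; rewrite oner_eq0.
  move=> w; have [->|w0] := eqVneq w 0; first by rewrite normr0 mulr0.
  have := umin (`|w|^-1 *: w); rewrite inE /S/= normrZ normfV normr_id.
  rewrite mulVf ?normr_eq0// => /(_ erefl).
  rewrite -[r2v (_ *: _)]/(W _) linearZ/= normrZ normfV normr_id.
  by rewrite ler_pdivlMl ?normr_gt0// mulrC.
rewrite (_ : mkset _ = W @` (W @^-1` [set v | `|v - c| <= r])); last first.
  apply/seteqP; split=> [v vc|_ [w wc <-]//].
  by exists (v2r v); rewrite /= v2rK.
apply: continuous_compact; first exact: continuous_subspaceT.
apply: bounded_closed_compact.
  exists (m^-1 * (r + `|c|)); split=> [|N Nr w /= wr]; first exact: num_real.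
  apply: le_trans (ltW Nr); rewrite ler_pdivlMl//.
  apply: le_trans (Wm w) _; rewrite -[W w](subrK c).
  by apply: le_trans (ler_normD _ _) _; rewrite lerD2r.
apply: closed_comp => [w _|]; first exact: Wcont.
apply: (@closed_comp _ _ (fun v : X => `|v - c|) [set x | x <= r]).
  by move=> v _; apply: cvg_norm; apply: cvgB; [exact: cvg_id|exact: cvg_cst].
exact: closed_le.
Qed.

Definition thicken {R : realType} {X : normedModType R} (A : set X) (r : R) :
  set X := [set v | exists2 a, A a & `|v - a| <= r].

Section Thicken.
Context {R : realType} {X : normedModType R}.
Implicit Types (A B : set X) (r s : R) (v : X).

Lemma thickenS A B r s : A `<=` B -> r <= s -> thicken A r `<=` thicken B s.
Proof. by move=> AB rs v [a /AB Ba /le_trans/(_ rs)]; exists a. Qed.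

Lemma thicken_thicken A r s : thicken (thicken A r) s `<=` thicken A (r + s).
Proof.
move=> v [b [a Aa ba] vb]; exists a => //.
by rewrite [r + s]addrC (le_trans (ler_distD b _ _))// lerD.
Qed.

Lemma thickenD A r s : 0 <= r -> 0 <= s ->
  thicken (thicken A r) s = thicken A (r + s).
Proof.
move=> r0 s0; apply/seteqP; split; first exact: thicken_thicken.
move=> v [a Aa va]; have [rs0|rs_gt0] := leP (r + s) 0.
  have r_0 : r = 0 by lra.
  have s_0 : s = 0 by lra.
  rewrite r_0 s_0 addr0 in va *; exists v; last by rewrite subrr normr0.
  by exists a.
pose t := s / (r + s); have t0 : 0 <= t by rewrite divr_ge0// ltW.
have tE : t * (r + s) = s by rewrite mulfVK// gt_eqF.
have t1 : 0 <= 1 - t by rewrite subr_ge0 ler_pdivrMr// mul1r; lra.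
exists (v - t *: (v - a)); last first.
  rewrite opprB addrC subrK normrZ ger0_norm// -[leRHS]tE.
  exact: ler_wpM2l.
exists a => //; rewrite addrAC -[v - a in X in X - _]scale1r -scalerBl.
rewrite normrZ ger0_norm// (le_trans (ler_wpM2l t1 va))//.
by rewrite mulrBl mul1r tE addrK.
Qed.

Lemma convex_norm_ball v r : convex_set [set w | `|w - v| <= r].
Proof.
apply/convex_setE => t x y t0 t1 /= xv yv.
have -> : t *: x + (1 - t) *: y - v = t *: (x - v) + (1 - t) *: (y - v).
  by rewrite !scalerBr addrACA -opprD -scalerDl subrKC scale1r.
rewrite (le_trans (ler_normD _ _))// !normrZ !ger0_norm ?subr_ge0//.
rewrite (_ : r = t * r + (1 - t) * r); last by ring.
by rewrite lerD// ler_wpM2l// subr_ge0.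
Qed.

Lemma convex_thicken A r : convex_set A -> convex_set (thicken A r).
Proof.
move=> /convex_setE cA; apply/convex_setE => t x y t0 t1 [a Aa xa] [b Ab yb].
exists (t *: a + (1 - t) *: b); first exact: cA.
have -> : t *: x + (1 - t) *: y - (t *: a + (1 - t) *: b) =
    t *: (x - a) + (1 - t) *: (y - b) - 0.
  by rewrite subr0 !scalerBr opprD addrACA.
by have /convex_setE := @convex_norm_ball 0 r; apply; rewrite //= subr0.
Qed.

Lemma compact_thicken n (dimX : Vector.axiom n X) A r :
  compact A -> compact (thicken A r).
Proof.
move=> cptA; rewrite (_ : thicken A r =
    (fun z : X * X => z.1 + z.2) @` (A `*` [set v | `|v - 0| <= r])).
  apply: continuous_compact; last first.
    by apply: compact_setX => //; exact: compact_norm_ball dimX _ _.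
  apply: continuous_subspaceT; exact: add_continuous.
apply/seteqP; split=> [v [a Aa va]|_ [[a b] [/= Aa br] <-]].
  by exists (a, v - a); rewrite /= ?subrKC// subr0.
by exists a => //; rewrite [a + b]addrC addrK -[b]subr0.
Qed.

End Thicken.

(** * Helly's theorem for compact families *)

Section CompactHelly.
Context {R : realType} {X : normedModType R} (dimX : Vector.axiom 2 X).

Lemma compact_bigcap (I : Type) (K : I -> set X) (i0 : I) :
  (forall i, compact (K i)) ->
  (forall s : seq I, exists v, forall i, List.In i s -> K i v) ->
  exists v, forall i, K i v.
Proof.
move=> cptK Ks.
pose B (s : seq I) : set X := [set v | forall i, List.In i s -> K i v].
have FF : ProperFilter (filter_from [set: seq I] B).
  apply: filter_from_proper => [|s _]; last exact: Ks.
  apply: filter_from_filter; first by exists [::].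
  move=> s t _ _; exists (s ++ t) => // v stv.
  by split=> i si; apply: stv; apply/List.in_or_app; [left|right].
have KB i : filter_from [set: seq I] B (K i).
  by exists [:: i] => // v; apply; left.
have [v [_ clv]] := cptK i0 _ FF (KB i0).
exists v => i; have : closed (K i).
  by apply: compact_closed => //; exact: norm_hausdorff.
by apply => U Uv; exact: clv.
Qed.

Lemma helly_compact (I : Type) (K : I -> set X) :
  (forall i, convex_set (K i)) -> (forall i, compact (K i)) ->
  (forall i j k, K i `&` K j `&` K k !=set0) ->
  exists v, forall i, K i v.
Proof.
move=> cK cptK K3.
have [[i0]|noI] := pselect (inhabited I); last first.
  by exists 0 => i; case: noI.
apply: (compact_bigcap i0) => // s.
have [|A B C|v sv] := @helly_seq _ _ dimX (map K s).
- by move=> A /List.in_map_iff[i [<- _]].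
- move=> /List.in_map_iff[i [<- _]] /List.in_map_iff[j [<- _]].
  by move=> /List.in_map_iff[k [<- _]].
- by exists v => i si; apply: sv; apply/List.in_map_iff; exists i.
Qed.

(** The ball around v joins the family: a triple that contains it meets by the
    hypothesis on pairs. *)
Lemma helly_thicken (I : Type) (K : I -> set X) (r : R) (v : X) :
  (forall i, convex_set (K i)) -> (forall i, compact (K i)) ->
  (forall i j k, K i `&` K j `&` K k !=set0) -> I ->
  (forall i j, thicken (K i `&` K j) r v) ->
  thicken [set a | forall i, K i a] r v.
Proof.
move=> cK cptK K3 i0 Kv.
pose K' (o : option I) : set X :=
  if o is Some i then K i else [set a | `|a - v| <= r].
have [||i j k|a aK] := @helly_compact _ K'.
- by case=> [i|]//=; exact: convex_norm_ball.
- by case=> [i|]//=; exact: compact_norm_ball dimX _ _.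
- case: i j k => [i|] [j|] [k|] /=; first exact: K3.
  + by have [a [Ki Kj]] := Kv i j; rewrite distrC; exists a.
  + by have [a [Ki Kj]] := Kv i k; rewrite distrC; exists a.
  + by have [a [Ki _]] := Kv i i; rewrite distrC; exists a.
  + by have [a [Ki Kj]] := Kv j k; rewrite distrC; exists a.
  + by have [a [Ki _]] := Kv j j; rewrite distrC; exists a.
  + by have [a [Ki _]] := Kv k k; rewrite distrC; exists a.
  + by have [a [Ki _]] := Kv i0 i0; rewrite distrC; exists a.
by exists a => [i|]; [exact: (aK (Some i))|rewrite distrC; exact: (aK None)].
Qed.

End CompactHelly.

(** * Pulling a point back into a ball *)

(** A point of C close to w and not much farther than l2 r from a can be replaced
    by a point of C in the ball of radius l2 r around a, provided that C comes
    within l1 r of a; th measures the loss in the distance to w. *)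
Definition pull_const {R : realType} (X : normedModType R) (l1 l2 th : R) :
  Prop := forall (C : set X) (a c0 w : X) (r s : R), convex_set C ->
    0 <= r -> 0 <= s -> C c0 -> `|c0 - a| <= l1 * r ->
    thicken C s w -> `|w - a| <= l2 * r + s ->
    exists c, [/\ C c, `|c - a| <= l2 * r & `|w - c| <= th * s].

Section PullConst.
Context {R : realType} {X : normedModType R} (l1 l2 : R).
Hypotheses (l1_gt0 : 0 < l1) (l12 : l1 < l2).

(** A point c1 of C near w is at distance at most l2 r + 2 s from a. It is moved
    towards c0 by the proportion that convexity of the norm requires. *)
Lemma pull_const_normed : pull_const X l1 l2 ((3 * l2 + l1) / (l2 - l1)).
Proof.
move=> C a c0 w r s /convex_setE cC r0 s0 Cc0 c0a [c1 Cc1 wc1] wa.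
have l21 : 0 < l2 - l1 by rewrite subr_gt0.
have c1a : `|c1 - a| <= l2 * r + 2 * s.
  by have := ler_distD w c1 a; rewrite [`|c1 - w|]distrC; lra.
have [s_gt0|s_le0] := ltP 0 s; last first.
  have s_eq0 : s = 0 by apply/eqP; rewrite eq_le s_le0.
  by exists c1; split=> //; move: wc1 c1a; rewrite s_eq0 !mulr0 ?addr0.
set D := (l2 - l1) * r + 2 * s.
have lr0 : 0 <= (l2 - l1) * r by rewrite mulr_ge0// ltW.
have D_gt0 : 0 < D by rewrite /D; lra.
(* The proportion t for which the convex combination of the bounds l1 r and
   l2 r + 2 s on the distances to a is l2 r. *)
pose t := 2 * s / D.
have t0 : 0 <= t by rewrite divr_ge0// ?mulr_ge0// ltW.
have t1 : t <= 1 by rewrite ler_pdivrMr// mul1r /D; lra.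
have tD : t * D = 2 * s by rewrite mulfVK// gt_eqF.
clearbody t; exists (t *: c0 + (1 - t) *: c1); split; first exact: cC.
  have -> : t *: c0 + (1 - t) *: c1 - a = t *: (c0 - a) + (1 - t) *: (c1 - a).
    by rewrite !scalerBr addrACA -opprD -scalerDl subrKC scale1r.
  rewrite (le_trans (ler_normD _ _))// !normrZ !ger0_norm ?subr_ge0//.
  have H1 : t * `|c0 - a| <= t * (l1 * r) by rewrite ler_wpM2l.
  have H2 : (1 - t) * `|c1 - a| <= (1 - t) * (l2 * r + 2 * s).
    by rewrite ler_wpM2l// subr_ge0.
  rewrite (le_trans (lerD H1 H2))// -subr_ge0.
  rewrite (_ : _ - _ = t * D - 2 * s); last by rewrite /D; ring.
  by rewrite tD subrr.
have -> : w - (t *: c0 + (1 - t) *: c1) = (w - c1) + t *: (c1 - c0).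
  rewrite scalerBl scale1r scalerBr opprD opprB [- (t *: c0) + _]addrC.
  by rewrite [t *: c1 - c1]addrC !addrA.
rewrite (le_trans (ler_normD _ _))// normrZ (ger0_norm t0).
have c10 : `|c1 - c0| <= (l1 + l2) * r + 2 * s.
  by have := ler_distD a c1 c0; rewrite [`|a - c0|]distrC; lra.
have H : t * `|c1 - c0| <= t * ((l1 + l2) * r + 2 * s) by rewrite ler_wpM2l.
have {}H := le_trans (lerD wc1 H) _; apply: H.
rewrite -mulrAC ler_pdivlMr// -subr_ge0.
rewrite (_ : _ - _ = s * (3 * l2 + l1) - (l2 - l1) * s - (l1 + l2) * (t * D)
                     + t * (4 * l1 * s)); last by rewrite /D; ring.
rewrite tD (_ : _ + _ = t * (4 * l1 * s)); last by ring.
by rewrite !mulr_ge0// ltW.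
Qed.

End PullConst.

Section PullConstEuclidean.
Context {R : realType} {X : normedModType R}.

Lemma euclidean_norm_expand : euclidean_norm X ->
  exists ip : X -> X -> R, forall p e t,
    `|p - t *: e| ^+ 2 = `|p| ^+ 2 - 2 * t * ip p e + t ^+ 2 * `|e| ^+ 2.
Proof.
move=> [ip ipE]; exists ip => p e t.
have sq x : `|x| ^+ 2 = ip x x.
  rewrite ipE sqr_sqrtr//; have [->|x0] := eqVneq x 0; first by rewrite linear0l.
  by rewrite ltW// neq0_dnorm_gt0.
have C x y : ip x y = ip y x by rewrite hermC expr0 mul1r.
rewrite !sq linearBl !linearBr !linearZl_LR !linearZr_LR/= (C e p).
by rewrite /GRing.scale/=; ring.
Qed.

(** A point c1 of C near w is at distance at most l2 r + 2 s from a. It is moved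
    towards c0 by the length tau = 2 s l2 / sqrt(l2^2 - l1^2), or to c0 if this
    is closer. If the new point were still outside the ball of radius l2 r,
    Pythagoras would put c1 too far from a: the line through c1 and c0 passes
    within l1 r of a, so the new point would be farther than
    r sqrt(l2^2 - l1^2) from the foot of the perpendicular from a, and c1 would
    be farther by tau. *)
Lemma pull_const_euclidean (l1 l2 : R) : 0 < l1 -> l1 < l2 ->
  euclidean_norm X ->
  pull_const X l1 l2 (1 + 2 * l2 / Num.sqrt (l2 ^+ 2 - l1 ^+ 2)).
Proof.
move=> l1_gt0 l12 /euclidean_norm_expand[ip ipE].
move=> C a c0 w r s /convex_setE cC r0 s0 Cc0 c0a [c1 Cc1 wc1] wa.
have l2_gt0 := lt_trans l1_gt0 l12.
have c1a : `|c1 - a| <= l2 * r + 2 * s.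
  by have := ler_distD w c1 a; rewrite [`|c1 - w|]distrC; lra.
have sq_gt0 : 0 < l2 ^+ 2 - l1 ^+ 2 by rewrite subr_sqr mulr_gt0//; lra.
set S := Num.sqrt _.
have S_gt0 : 0 < S by rewrite sqrtr_gt0.
have S2 : S ^+ 2 = l2 ^+ 2 - l1 ^+ 2 by rewrite sqr_sqrtr// ltW.
have Sl2 : S <= l2.
  rewrite -(@ler_pXn2r _ 2) ?nnegrE ?(ltW S_gt0) ?(ltW l2_gt0)//.
  by rewrite S2 gerBl sqr_ge0.
pose tau := 2 * s * l2 / S.
have tauS : tau * S = 2 * s * l2 by rewrite mulfVK// gt_eqF.
have tau2s : 2 * s <= tau by rewrite ler_pdivlMr// ler_wpM2l// mulr_ge0.
have -> : (1 + 2 * l2 / S) * s = s + tau by rewrite /tau; ring.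
clearbody tau.
have l1r : l1 * r <= l2 * r by rewrite ler_wpM2r// ltW.
have l1r0 : 0 <= l1 * r by rewrite mulr_ge0// ltW.
have l2r0 : 0 <= l2 * r by rewrite mulr_ge0// ltW.
have Sr0 : 0 <= S * r by rewrite mulr_ge0// ltW.
have [c1c0|c1c0] := leP `|c1 - c0| tau.
  exists c0; split=> //; first exact: le_trans c0a l1r.
  by rewrite (le_trans (ler_distD c1 _ _))// lerD.
set D := `|c1 - c0| in c1c0; have D_gt0 : 0 < D by lra.
have tau0 : 0 <= tau by lra.
have tD : tau / D * D = tau by rewrite mulfVK// gt_eqF.
exists (c1 - (tau / D) *: (c1 - c0)); split.
- rewrite (_ : _ - _ = (tau / D) *: c0 + (1 - tau / D) *: c1).
    apply: cC => //; first by rewrite divr_ge0// ltW.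
    by rewrite ler_pdivrMr// mul1r ltW.
  by rewrite scalerBr scalerBl scale1r opprB addrCA addrA.
- rewrite addrAC -(@ler_pXn2r _ 2) ?nnegrE//.
  rewrite leNgt; apply/negP => far; move: (far).
  rewrite ipE -/D -exprMn tD.
  set b := ip (c1 - a) (c1 - c0) / D.
  have ipD : ip (c1 - a) (c1 - c0) = b * D by rewrite mulfVK// gt_eqF.
  rewrite (_ : 2 * (tau / D) * _ = 2 * tau * b); last by rewrite /b; ring.
  have q2 : `|c1 - a| ^+ 2 - 2 * b * D + D ^+ 2 <= (l1 * r) ^+ 2.
    have := ipE (c1 - a) (c1 - c0) 1.
    rewrite scale1r opprB [c1 - a + _]addrC subrKA -/D ipD expr1n mulr1 mul1r.
    rewrite mulrA => <-.
    by rewrite ler_pXn2r ?nnegrE.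
  have p2 : `|c1 - a| ^+ 2 <= (l2 * r + 2 * s) ^+ 2.
    by rewrite ler_pXn2r ?nnegrE// addr_ge0// mulr_ge0.
  have l12r : (l1 * r) ^+ 2 <= (l2 * r) ^+ 2.
    by rewrite ler_pXn2r ?nnegrE.
  move: q2 p2; set P := `|_| ^+ 2 => q2 p2 far'.
  (* b is the position, measured from c1 towards c0, of the foot of the
     perpendicular from a. *)
  have [btau|btau] := ltP b tau.
    have : 0 < (D - tau) * (D + tau - 2 * b) by rewrite mulr_gt0; lra.
    by lra.
  have Pb : P - b ^+ 2 <= (l1 * r) ^+ 2 by have := sqr_ge0 (b - D); lra.
  have xS : S * r < b - tau.
    rewrite -(@ltr_pXn2r _ 2) ?nnegrE ?subr_ge0//.
    rewrite exprMn S2; lra.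
  have : 2 * tau * (S * r) <= 2 * tau * (b - tau).
    by rewrite ler_wpM2l ?mulr_ge0//; exact: ltW.
  rewrite (_ : 2 * tau * (S * r) = 2 * (tau * S) * r); last by ring.
  rewrite tauS.
  have : (2 * s) ^+ 2 <= tau ^+ 2 by rewrite ler_pXn2r ?nnegrE// mulr_ge0.
  by lra.
- rewrite opprB addrA addrAC.
  rewrite (le_trans (ler_normD _ _))// lerD//.
  by rewrite normrZ ger0_norm ?divr_ge0 ?(ltW D_gt0)// -/D tD.
Qed.

End PullConstEuclidean.

(** * From three conditions to a point of the intersection *)

Section PullIntersection.
Context {R : realType} {X : normedModType R} (dimX : Vector.axiom 2 X).

(** By Helly's theorem a point a common to C1 and C2 lies both near C and near
    v. The point of C near v is then pulled towards a. *)
Lemma pull_inter (l1 l2 th r s : R) (C1 C2 C : set X) (v : X) :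
  0 < l1 -> l1 < l2 -> pull_const X l1 l2 th -> 0 <= r -> 0 <= s ->
  convex_set C1 -> convex_set C2 -> convex_set C ->
  C1 `&` C2 `&` thicken C (l1 * r) !=set0 ->
  thicken (C1 `&` C2) (l2 * r + s) v ->
  thicken (thicken C1 (l1 * r) `&` C) s v ->
  thicken (thicken C2 (l1 * r) `&` C) s v ->
  thicken (thicken (C1 `&` C2) (l2 * r) `&` C) (th * s) v.
Proof.
move=> l1_gt0 l12 pull r0 s0 cC1 cC2 cC C12C [b [C1b C2b] vb].
have l1r : l1 * r <= l2 * r by rewrite ler_wpM2r// ltW.
have near_v (A : set X) : thicken (thicken A (l1 * r) `&` C) s v ->
    exists a, [/\ A a, thicken C (l1 * r) a & `|a - v| <= l2 * r + s].
  move=> [c [[a Aa ca] Cc] vc]; exists a; split=> //.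
    by exists c; rewrite // distrC.
  by rewrite distrC (le_trans (ler_distD c _ _))//; lra.
move=> C1v C2v.
have [a1 [Aa1 Ca1 va1]] := near_v _ C1v; have [a2 [Aa2 Ca2 va2]] := near_v _ C2v.
have [a [C1a C2a [c0 Cc0 ac0] va]] : exists a,
    [/\ C1 a, C2 a, thicken C (l1 * r) a & `|a - v| <= l2 * r + s].
  apply: (helly4 dimX) => //.
  - exact: convex_thicken.
  - exact: convex_norm_ball.
  - by exists b; rewrite /= distrC.
  - by exists a1.
  - by exists a2.
case: C1v => c [_ Cc] vc.
have c0a : `|c0 - a| <= l1 * r by rewrite distrC.
have va' : `|v - a| <= l2 * r + s by rewrite distrC.
have Cv : thicken C s v by exists c.
have [c' [Cc' c'a vc']] := pull C a c0 v r s cC r0 s0 Cc0 c0a Cv va'.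
by exists c' => //; split=> //; exists a.
Qed.

End PullIntersection.

(** * The refinements for a finite-valued pseudometric *)

Section Core.
Context {R : realType} {X : normedModType R} (dimX : Vector.axiom 2 X).
Context {N : Type} (d : N -> N -> R) (F : N -> set X) (l1 l2 : R).
Hypotheses (d_ge0 : forall x y, 0 <= d x y)
  (d_sym : forall x y, d x y = d y x)
  (d_tri : forall x y z, d x y <= d x z + d z y).
Hypotheses (F_cvx : forall x, convex_set (F x))
  (F_cpt : forall x, compact (F x)).
Hypotheses (l1_gt0 : 0 < l1) (l12 : 3 * l1 <= l2).
Hypothesis sel4 : forall u1 u2 u3 u4, exists g : N -> X,
  [/\ forall x y, `|g x - g y| <= l1 * d x y,
      F u1 (g u1), F u2 (g u2), F u3 (g u3) & F u4 (g u4)].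

(** The region in which F(u) confines, at z, the values of the maps of constant
    l1 that select from F at u. *)
Definition seen (z u : N) : set X := thicken (F u) (l1 * d z u).
Definition refine1 (z : N) : set X := [set v | forall u, seen z u v].
Definition refine2 (x : N) : set X :=
  [set v | forall z, thicken (refine1 z) (l2 * d x z) v].
Definition seen2 (z u u' : N) : set X := seen z u `&` seen z u'.
(** The members of the family whose intersection is the second refinement. *)
Definition reach (x : N) (p : N * N * N) : set X :=
  thicken (seen2 p.1.1 p.1.2 p.2) (l2 * d x p.1.1).

Let l1_lt_l2 : l1 < l2.
Proof. by move: l1_gt0 l12; lra. Qed.

Let l2_gt0 : 0 < l2.
Proof. exact: lt_trans l1_lt_l2. Qed.

Let l1M x y : 0 <= l1 * d x y.
Proof. by rewrite mulr_ge0// ltW. Qed.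

Let l2M x y : 0 <= l2 * d x y.
Proof. by rewrite mulr_ge0// ltW. Qed.

Lemma sel4_seen u1 u2 u3 u4 : exists g : N -> X,
  (forall x y, `|g x - g y| <= l1 * d x y) /\
  forall z, [/\ seen z u1 (g z), seen z u2 (g z), seen z u3 (g z)
    & seen z u4 (g z)].
Proof.
have [g [glip g1 g2 g3 g4]] := sel4 u1 u2 u3 u4.
by exists g; split=> // z; split; [exists (g u1)|exists (g u2)|exists (g u3)
  |exists (g u4)].
Qed.

Lemma convex_seen z u : convex_set (seen z u).
Proof. exact: convex_thicken. Qed.

Lemma compact_seen z u : compact (seen z u).
Proof. exact: (compact_thicken dimX). Qed.

Lemma convex_seen2 z u u' : convex_set (seen2 z u u').
Proof. by apply: convex_setI; exact: convex_seen. Qed.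

Lemma compact_seen2 z u u' : compact (seen2 z u u').
Proof.
apply: compact_closedI; first exact: compact_seen.
by apply: compact_closed; [exact: norm_hausdorff|exact: compact_seen].
Qed.

Lemma seen_meet z u1 u2 u3 : seen z u1 `&` seen z u2 `&` seen z u3 !=set0.
Proof.
by have [g [_ /(_ z)[]]] := sel4_seen u1 u2 u3 u3; exists (g z).
Qed.

Lemma refine1_nonempty z : refine1 z !=set0.
Proof.
apply: (helly_compact dimX) => [u|u|u1 u2 u3].
- exact: convex_seen.
- exact: compact_seen.
- exact: seen_meet.
Qed.

(** Helly's theorem lets two constraints at a time decide membership in a
    thickened intersection. *)
Lemma refine2E x v : refine2 x v <-> forall p, reach x p v.
Proof.
split=> [Fv [[z u] u']|Fv z].
  by apply: thickenS (Fv z) => // a Fa; split; exact: Fa.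
apply: (helly_thicken dimX) => [u|u|||u u'].
- exact: convex_seen.
- exact: compact_seen.
- exact: seen_meet.
- exact: z.
- exact: (Fv (z, u, u')).
Qed.

(** Five of the sets F(u) are involved. Any three of the four sets to which
    Helly's theorem applies involve at most four of them, and a Lipschitz
    selection at these gives a common point. *)
Lemma seen2_between z1 z2 z3 u1 u2 u2' u3 u3' : exists v,
  [/\ seen2 z2 u2 u2' v, thicken (seen z1 u1) (l1 * d z1 z2) v
    & thicken (seen2 z3 u3 u3') (l1 * d z2 z3) v].
Proof.
have [v [v2 v2' v1 v3]] : exists v, [/\ seen z2 u2 v, seen z2 u2' v,
    thicken (seen z1 u1) (l1 * d z1 z2) v &
    thicken (seen2 z3 u3 u3') (l1 * d z2 z3) v].
  apply: (helly4 dimX); try exact: convex_seen.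
  - by apply: convex_thicken; exact: convex_seen.
  - by apply: convex_thicken; exact: convex_seen2.
  - have [g [glip gs]] := sel4_seen u1 u2 u2' u2'.
    have [g1 _ _ _] := gs z1; have [_ g2 g2' _] := gs z2.
    by exists (g z2); split=> //; exists (g z1); rewrite // distrC.
  - have [g [glip gs]] := sel4_seen u2 u2' u3 u3'.
    have [g2 g2' _ _] := gs z2; have [_ _ g3 g3'] := gs z3.
    by exists (g z2); split=> //; exists (g z3).
  - have [g [glip gs]] := sel4_seen u1 u2 u3 u3'.
    have [g1 _ _ _] := gs z1; have [_ g2 _ _] := gs z2.
    have [_ _ g3 g3'] := gs z3.
    exists (g z2); split; last by exists (g z3).
    by split=> //; exists (g z1); rewrite // distrC.
  - have [g [glip gs]] := sel4_seen u1 u2' u3 u3'.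
    have [g1 _ _ _] := gs z1; have [_ g2 _ _] := gs z2.
    have [_ _ g3 g3'] := gs z3.
    exists (g z2); split; last by exists (g z3).
    by split=> //; exists (g z1); rewrite // distrC.
by exists v; split.
Qed.

(** The nearest of the three sets seen from z1, z2, z3 contains a point y1 that
    is close to the two others, by Helly's theorem again. The common point lies
    at distance at most l1 r1 from y1 on the way to the farthest set; the three
    distances to cover are then at most l1 r1, 3 l1 r2 and 3 l1 r3. *)
Lemma reach_meet_sorted x p1 p2 p3 :
  d x p1.1.1 <= d x p2.1.1 -> d x p2.1.1 <= d x p3.1.1 ->
  exists v, [/\ reach x p1 v, reach x p2 v & reach x p3 v].
Proof.
case: p1 p2 p3 => [[z1 u1] u1'] [[z2 u2] u2'] [[z3 u3] u3'] /=.
set r1 := d x z1; set r2 := d x z2; set r3 := d x z3 => r12 r23.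
have r1_ge0 : 0 <= r1 by exact: d_ge0.
have r2_ge0 : 0 <= r2 by exact: d_ge0.
have r3_ge0 : 0 <= r3 by exact: d_ge0.
have d12 : d z1 z2 <= r1 + r2 by rewrite /r1 (d_sym x z1); exact: d_tri.
have d13 : d z1 z3 <= r1 + r3 by rewrite /r1 (d_sym x z1); exact: d_tri.
have d23 : d z2 z3 <= r2 + r3 by rewrite /r2 (d_sym x z2); exact: d_tri.
have le_l1 (a b : R) : a <= b -> l1 * a <= l1 * b by rewrite ler_pM2l.
have near23 u : seen z1 u `&` thicken (seen2 z2 u2 u2') (l1 * (r1 + r2)) `&`
    thicken (seen2 z3 u3 u3') (l1 * (r1 + 2 * r2 + r3)) !=set0.
  have [q [q2 [c C1c qc] [a A3a qa]]] := seen2_between z1 z2 z3 u u2 u2' u3 u3'.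
  exists c; split; first split=> //.
    by exists q; rewrite // distrC (le_trans qc)// le_l1.
  exists a => //; rewrite (le_trans (ler_distD q _ _))// [`|c - q|]distrC.
  rewrite (le_trans (lerD qc qa))// -mulrDr le_l1//; lra.
have [y1 [y1u y1u' [y2 A2y2 y12] [y3 A3y3 y13]]] : exists v,
    [/\ seen z1 u1 v, seen z1 u1' v,
      thicken (seen2 z2 u2 u2') (l1 * (r1 + r2)) v &
      thicken (seen2 z3 u3 u3') (l1 * (r1 + 2 * r2 + r3)) v].
  apply: (helly4 dimX) => //; try exact: convex_seen.
  - by apply: convex_thicken; exact: convex_seen2.
  - by apply: convex_thicken; exact: convex_seen2.
  - have [g [glip gs]] := sel4_seen u1 u1' u2 u2'.
    have [g1 g1' _ _] := gs z1; have [_ _ g2 g2'] := gs z2.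
    exists (g z1); split=> //; exists (g z2) => //.
    by rewrite (le_trans (glip _ _))// le_l1.
  - have [g [glip gs]] := sel4_seen u1 u1' u3 u3'.
    have [g1 g1' _ _] := gs z1; have [_ _ g3 g3'] := gs z3.
    exists (g z1); split=> //; exists (g z3) => //.
    by rewrite (le_trans (glip _ _))// le_l1//; lra.
(* The segment from y1 to y3 may degenerate; otherwise the point at the
   proportion r1 / D is taken on it. *)
set D := r1 + 2 * r2 + r3 in y13.
have [D0|D_gt0] := leP D 0.
  have r1_0 : r1 = 0 by rewrite /D in D0; lra.
  have r2_0 : r2 = 0 by rewrite /D in D0; lra.
  have r3_0 : r3 = 0 by rewrite /D in D0; lra.
  have D_0 : D = 0 by rewrite /D r1_0 r2_0 r3_0; ring.
  exists y1; rewrite /reach/= -/r1 -/r2 -/r3 r1_0 r2_0 r3_0 !mulr0.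
  split; first by exists y1; rewrite // subrr normr0.
    by exists y2 => //; move: y12; rewrite r1_0 r2_0 addr0 mulr0.
  by exists y3 => //; move: y13; rewrite D_0 mulr0.
pose t := r1 / D.
have t0 : 0 <= t by rewrite divr_ge0// ltW.
have t1 : t <= 1 by rewrite ler_pdivrMr// mul1r /D; lra.
have tD : t * D = r1 by rewrite mulfVK// gt_eqF.
clearbody t.
have l1r3 : l1 * (2 * r2 + r3) <= l2 * r3.
  rewrite (@le_trans _ _ (3 * l1 * r3))//; last by rewrite ler_wpM2r.
  by rewrite (_ : 3 * l1 * r3 = l1 * (3 * r3)) ?le_l1//; [lra|ring].
have l1r2 : l1 * (2 * r1 + r2) <= l2 * r2.
  rewrite (@le_trans _ _ (3 * l1 * r2))//; last by rewrite ler_wpM2r.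
  by rewrite (_ : 3 * l1 * r2 = l1 * (3 * r2)) ?le_l1//; [lra|ring].
have py1 : `|y1 - t *: (y1 - y3) - y1| <= l1 * r1.
  rewrite addrAC subrr add0r normrN normrZ ger0_norm//.
  by rewrite (le_trans (ler_wpM2l t0 y13))// mulrCA tD.
exists (y1 - t *: (y1 - y3)); split.
- exists y1 => //; rewrite (le_trans py1)//=.
  by rewrite ler_wpM2r// ltW.
- exists y2 => //=; rewrite (le_trans (ler_distD y1 _ _))//.
  by rewrite (le_trans (lerD py1 y12))// -/r2; lra.
- exists y3 => //=; rewrite -/r3 (le_trans _ l1r3)//.
  have -> : y1 - t *: (y1 - y3) - y3 = (1 - t) *: (y1 - y3).
    by rewrite scalerBl scale1r addrAC.
  rewrite normrZ ger0_norm ?subr_ge0//.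
  have t1' : 0 <= 1 - t by rewrite subr_ge0.
  rewrite (le_trans (ler_wpM2l t1' y13))//.
  rewrite (_ : (1 - t) * (l1 * D) = l1 * D - l1 * (t * D)); last by ring.
  rewrite tD /D; lra.
Qed.

Lemma reach_meet x p1 p2 p3 :
  reach x p1 `&` reach x p2 `&` reach x p3 !=set0.
Proof.
have S := @reach_meet_sorted x.
have [r12|/ltW r12] := leP (d x p1.1.1) (d x p2.1.1);
have [r23|/ltW r23] := leP (d x p2.1.1) (d x p3.1.1);
have [r13|/ltW r13] := leP (d x p1.1.1) (d x p3.1.1).
- by have [v []] := S _ _ _ r12 r23; exists v.
- by have [v []] := S _ _ _ r12 r23; exists v.
- by have [v []] := S _ _ _ r13 r23; exists v.
- by have [v []] := S _ _ _ r13 r12; exists v.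
- by have [v []] := S _ _ _ r12 r13; exists v.
- by have [v []] := S _ _ _ r23 r13; exists v.
- by have [v []] := S _ _ _ r23 r12; exists v.
- by have [v []] := S _ _ _ r23 r12; exists v.
Qed.

Lemma convex_reach x p : convex_set (reach x p).
Proof. by apply: convex_thicken; exact: convex_seen2. Qed.

Lemma compact_reach x p : compact (reach x p).
Proof. by apply: (compact_thicken dimX); exact: compact_seen2. Qed.

Lemma refine2_nonempty x : refine2 x !=set0.
Proof.
have [|||v Fv] := @helly_compact _ _ dimX _ (reach x).
- exact: convex_reach.
- exact: compact_reach.
- exact: reach_meet.
- by exists v; apply/refine2E.
Qed.

(** It suffices to find a point near v in two of the sets whose intersection is
    the refinement at y. They are thickened intersections at z1 and at z2. The
    first step reaches the second one together with one single set seen from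
    z1, the second step reaches both; each costs a factor th. *)
Lemma refine2_lipschitz th x y : 1 <= th -> pull_const X l1 l2 th ->
  refine2 x `<=` thicken (refine2 y) (l2 * th ^+ 2 * d x y).
Proof.
move=> th1 pull v Fv.
have -> : refine2 y = [set a | forall p, reach y p a].
  by apply/seteqP; split=> a /refine2E.
apply: (helly_thicken dimX); [exact: convex_reach|exact: compact_reach
  |exact: reach_meet|exact: (x, x, x)|].
move=> [[z1 u1] u1'] [[z2 u2] u2'].
set s := l2 * d x y; have s0 : 0 <= s by exact: l2M.
have th0 : 0 <= th by lra.
have ths : s <= th * s by rewrite ler_peMl.
have far z u u' t : s <= t -> thicken (seen2 z u u') (l2 * d y z + t) v.
  move=> st; apply: thickenS (Fv z) => [a Fa|]; first by split; exact: Fa.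
  by apply: le_trans (lerD (lexx _) st); rewrite addrC /s -mulrDr ler_pM2l.
have seenS z u : seen y u `<=` thicken (seen z u) (l1 * d y z).
  rewrite thickenD//; apply: thickenS => //.
  by rewrite -mulrDr ler_pM2l// addrC; exact: d_tri.
have step1 u : thicken (reach y (z2, u2, u2') `&`
    thicken (seen z1 u) (l1 * d y z1)) (th * s) v.
  apply: (pull_inter dimX l1_gt0 l1_lt_l2 pull) => //; try exact: convex_seen.
  - by apply: convex_thicken; exact: convex_seen.
  - have [g [glip gs]] := sel4_seen u2 u2' u u.
    have [g2 g2' _ _] := gs z2; have [_ _ g1 _] := gs z1.
    exists (g z2); split=> //; exists (g y); last by rewrite d_sym.
    by exists (g z1).
  - exact: far.
  - apply: thickenS (Fv y) => // a Fa.
    by split; apply: seenS; exact: Fa.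
  - apply: thickenS (Fv y) => // a Fa.
    by split; apply: seenS; exact: Fa.
rewrite (_ : l2 * th ^+ 2 * d x y = th * (th * s)); last by rewrite /s; ring.
apply: (pull_inter dimX l1_gt0 l1_lt_l2 pull) => //; try exact: convex_seen.
- by rewrite mulr_ge0.
- exact: convex_reach.
- have [g [glip gs]] := sel4_seen u1 u1' u2 u2'.
  have [g1 g1' _ _] := gs z1; have [_ _ g2 g2'] := gs z2.
  exists (g z1); split=> //; exists (g y); last by rewrite d_sym.
  exists (g z2) => //; apply: le_trans (glip _ _) _.
  by rewrite ler_wpM2r// ltW.
- exact: far.
- by rewrite setIC; exact: step1.
- by rewrite setIC; exact: step1.
Qed.

End Core.

(** * Limits of selections *)

Lemma ultra_cvg (S : Type) (T : topologicalType) (G : set_system S)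
    (f : S -> T) (A : set T) :
  UltraFilter G -> compact A -> G (f @^-1` A) ->
  exists2 p, A p & f x @[x --> G] --> p.
Proof.
move=> UG; rewrite compact_ultra => cptA GA.
have UfG : UltraFilter (f x @[x --> G]).
  have PG : ProperFilter G by exact: ultra_proper.
  split=> [|H PH GH]; first exact: fmap_proper_filter.
  apply/seteqP; split=> // B HB.
  have [//|GnB] := in_ultra_setVsetC (f @^-1` B) UG.
  have /filter_ex[b []//] : H (B `&` ~` B).
  by apply: filterI => //; exact: GH.
by have [p [Ap fp]] := cptA _ UfG GA; exists p.
Qed.

(** The approximate selections are followed along an ultrafilter. At each point
    they stay in a compact set, a ball around the values at one constrained
    point, so they converge. *)
Lemma lipschitz_compactness (R : realType) (X : normedModType R) (n : nat)
    (dimX : Vector.axiom n X) (N : Type) (d : N -> N -> R)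
    (F : N -> set X) (P : set N) (l : R) (u0 : N) :
  (forall x y, 0 <= d x y) -> (forall u, compact (F u)) -> P u0 -> 0 <= l ->
  (forall e, 0 < e -> exists g : N -> X,
    (forall x y, `|g x - g y| <= (l + e) * d x y) /\
    forall u, P u -> F u (g u)) ->
  exists g : N -> X,
    (forall x y, `|g x - g y| <= l * d x y) /\ forall u, P u -> F u (g u).
Proof.
move=> d_ge0 cptF Pu0 l0 approx.
have /boolp.choice[g gP] : forall e : R, exists g : N -> X, 0 < e ->
    (forall x y, `|g x - g y| <= (l + e) * d x y) /\
    forall u, P u -> F u (g u).
  move=> e; have [e0|e0] := ltP 0 e; last by exists (fun=> 0).
  by have [g ?] := approx _ e0; exists g.
have [G [UG GE]] := ultraFilterLemma (at_right_proper_filter (0 : R)).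
have Gpos : \forall e \near G, 0 < e.
  by apply: GE; exact: nbhs_right_gt.
have /boolp.choice[h hP] : forall x : N, exists p : X, g e x @[e --> G] --> p.
  move=> x; have cptx := compact_thicken dimX (r := (l + 1) * d x u0) (cptF u0).
  have [|p _ gp] := @ultra_cvg _ _ G (g^~ x) _ UG cptx; last by exists p.
  have Gle1 : \forall e \near G, e <= 1 by apply: GE; exact: nbhs_right_le.
  near=> e; have e0 : 0 < e by near: e.
  have [lip sel] := gP e e0; exists (g e u0); first exact: sel.
  rewrite /= (le_trans (lip _ _))// ler_wpM2r// lerD2l.
  by near: e.
exists h; split=> [x y|u Pu]; last first.
  apply: (closed_cvg (F u) _ _ (h u) (hP u)).
    by apply: compact_closed => //; exact: norm_hausdorff.
  by near=> e; have [|_] := gP e _; [near: e|apply].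
apply/ler_addgt0Pr => e e0.
have [del del0 dele] : exists2 del, 0 < del & del * d x y <= e.
  exists (e / (1 + d x y)); first by rewrite divr_gt0// ltr_pwDl.
  rewrite mulrAC ler_pdivrMr ?ltr_pwDl//.
  by rewrite ler_pM2l// lerDr.
have hxy : `|g e x - g e y| @[e --> G] --> `|h x - h y|.
  by apply: cvg_norm; exact: cvgB (hP x) (hP y).
apply: (closed_cvg [set z | z <= l * d x y + e] _ _ _ hxy); first exact: closed_le.
have Gdel : \forall e \near G, e <= del by apply: GE; exact: nbhs_right_le.
near=> f; have f0 : 0 < f by near: f.
have [lip _] := gP f f0; rewrite /= (le_trans (lip _ _))// mulrDl lerD2l.
rewrite (le_trans _ dele)// ler_wpM2r//.
by near: f.
Unshelve. all: by end_near. Qed.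

(** * Extended pseudometrics *)

Section Extended.
Context {R : realType} {M : Type} {X : normedModType R}.
Variable rho : M -> M -> \bar R.
Hypothesis rho_pm : pseudometric rho.

Lemma lip_seminorm_le (A : set M) (f : M -> X) (c r : R) (x y : M) :
  (lip_seminorm rho A f <= c%:E)%E -> A x -> A y -> rho x y = r%:E ->
  `|f x - f y| <= c * r.
Proof.
move=> fc Ax Ay rE; have r0 : 0 <= r by have [/(_ x y)] := rho_pm; rewrite rE.
have adm (l : R) : (forall x y, A x -> A y ->
    ((`|f x - f y|)%:E <= l%:E * rho x y)%E) -> `|f x - f y| <= l * r.
  by move=> /(_ x y Ax Ay); rewrite rE -EFinM lee_fin.
have [r_gt0|r_le0] := ltP 0 r; last first.
  have r_0 : r = 0 by apply/eqP; rewrite eq_le r_le0.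
  have /ereal_inf_lt[_ [l [_ fl] <-] _] := le_lt_trans fc (ltry c).
  by have := adm _ fl; rewrite r_0 !mulr0.
rewrite -ler_pdivrMr// -lee_fin; apply: le_trans fc.
apply/ereal_infP => _ [l [_ fl] <-].
by rewrite lee_fin ler_pdivrMr//; exact: adm.
Qed.

Lemma lip_ext_const_extend (l : R) : (lip_ext_const rho X < l%:E)%E ->
  forall (A : set M) (f : M -> X), lipschitz_map rho A f ->
    (lip_seminorm rho A f <= 1)%E ->
    exists g : M -> X, (forall x, A x -> g x = f x) /\
      (lip_seminorm rho setT g <= l%:E)%E.
Proof.
move=> /ereal_inf_lt[_ [k [k0 kE] <-] kl] A f fL f1.
have [g [_ gf gk]] := kE A f fL; exists g; split=> //.
apply: (le_trans gk); apply: le_trans (ltW kl).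
rewrite -[leRHS]mule1; apply: lee_wpmul2l => //.
by rewrite lee_fin ltW.
Qed.

End Extended.

(** * Reduction to points at finite distance *)

Lemma minkowski_cball (R : realType) (X : normedModType R) (A : set X) (r : R) :
  minkowski_sum A (cball r%:E) = thicken A r.
Proof.
apply/seteqP; split=> [_ [a Aa [b br <-]]|v [a Aa va]].
  by exists a; rewrite // [a + b]addrC addrK -lee_fin.
by exists a => //; exists (v - a); rewrite ?subrKC// /cball/= lee_fin.
Qed.

Lemma hausdorff_dist_le (R : realType) (X : normedModType R) (A B : set X)
    (c : R) : 0 <= c -> A `<=` thicken B c -> B `<=` thicken A c ->
  (hausdorff_dist A B <= c%:E)%E.
Proof.
move=> c0 AB BA; apply/lee_addgt0Pr => e e0; apply: ge_ereal_inf.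
exists (c + e)%:E => //; exists (c + e) => //; split; first exact: ltr_wpDl.
rewrite !minkowski_cball; have ce : c <= c + e by rewrite lerDl ltW.
by split; [apply: subset_trans BA _|apply: subset_trans AB _]; exact: thickenS.
Qed.

Section Component.
Context {R : realType} {M : Type} {rho : M -> M -> \bar R}.
Hypothesis rho_pm : pseudometric rho.
Variable x0 : M.

Definition component := {y : M | (rho x0 y < +oo)%E}.
Definition cdist (y z : component) : R := fine (rho (sval y) (sval z)).

Lemma cdistE y z : rho (sval y) (sval z) = (cdist y z)%:E.
Proof.
have [rho_ge0 _ rho_sym rho_tri] := rho_pm.
rewrite /cdist fineK// ge0_fin_numE//.
apply: le_lt_trans (rho_tri _ _ x0) _; rewrite (rho_sym _ x0).
by apply: lte_add_pinfty; [exact: (svalP y)|exact: (svalP z)].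
Qed.

Lemma cdist_ge0 y z : 0 <= cdist y z.
Proof. by have [rho_ge0 _ _ _] := rho_pm; rewrite -lee_fin -cdistE. Qed.

Lemma cdistC y z : cdist y z = cdist z y.
Proof. by have [_ _ rho_sym _] := rho_pm; rewrite /cdist rho_sym. Qed.

Lemma cdist_tri x y z : cdist x y <= cdist x z + cdist z y.
Proof.
have [_ _ _ rho_tri] := rho_pm.
by rewrite -lee_fin EFinD -!cdistE.
Qed.

(** Points at infinite distance impose no condition. *)
Lemma refinement_component (X : normedModType R) (F : M -> set X) (l : R)
    (z : component) : (forall x, F x !=set0) -> 0 < l ->
  refinement rho l F (sval z) =
  [set v | forall u : component, thicken (F (sval u)) (l * cdist z u) v].
Proof.
have [rho_ge0 _ _ rho_tri] := rho_pm.
move=> F0 l0; apply/seteqP; split=> [v Fv u|v Fv w _].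
  by have := Fv (sval u) I; rewrite cdistE -EFinM minkowski_cball.
have [xw|xw] := ltP (rho x0 w) +oo%E.
  rewrite -[w]/(sval (exist _ w xw : component)) cdistE -EFinM minkowski_cball.
  exact: Fv.
have -> : rho (sval z) w = +oo%E.
  apply/eqP; rewrite -leye_eq leNgt; apply/negP => zw.
  have := le_lt_trans xw (le_lt_trans (rho_tri x0 w (sval z))
    (lte_add_pinfty (svalP z) zw)).
  by rewrite ltxx.
rewrite gt0_muley ?lte_fin//; have [a Fa] := F0 w.
by exists a => //; exists (v - a); rewrite ?subrKC// /cball/= leey.
Qed.

End Component.

Section Assembly.
Context {R : realType} {M : Type} {rho : M -> M -> \bar R}.
Hypothesis rho_pm : pseudometric rho.
Context {X : completeNormedModType R} (dimX : Vector.axiom 2 X).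
Context {F : M -> set X}.
Hypothesis F_cvx_cpt :
  forall x, [/\ F x !=set0, convex_set (F x) & compact (F x)].
Hypothesis F_sel : forall A : set M, (A #<= `I_4)%card ->
  exists f : M -> X, [/\ lipschitz_map rho A f, selection A F f
                       & (lip_seminorm rho A f <= 1)%E].

(** The extension constant turns a selection at four points into a map defined
    everywhere, with a constant as close to l1 as desired. *)
Lemma component_sel4 (l1 : R) (x0 : M) : 0 < l1 ->
  (lip_ext_const rho X <= l1%:E)%E ->
  forall u1 u2 u3 u4 : component (rho := rho) x0,
  exists g : component (rho := rho) x0 -> X,
  [/\ forall x y, `|g x - g y| <= l1 * cdist x y,
      F (sval u1) (g u1), F (sval u2) (g u2), F (sval u3) (g u3)
    & F (sval u4) (g u4)].
Proof.
move=> l1_gt0 el1 u1 u2 u3 u4.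
pose us : seq (component (rho := rho) x0) := [:: u1; u2; u3; u4].
pose A : set M := (fun n => sval (nth u1 us n)) @` `I_4.
have Au k : (k < 4)%N -> A (sval (nth u1 us k)) by move=> k4; exists k.
have [f [fL fF f1]] := F_sel (card_image_le _ `I_4 : (A #<= `I_4)%card).
pose P := [set u : component (rho := rho) x0 | A (sval u)].
have Pu k : (k < 4)%N -> P (nth u1 us k) by exact: Au.
have [||||g [glip gF]] := @lipschitz_compactness _ _ _ dimX _ (@cdist _ _ rho x0)
  (F \o sval) P l1 u1 (cdist_ge0 rho_pm (x0 := x0)).
- by move=> u; have [] := F_cvx_cpt (sval u).
- exact: (Pu 0%N).
- exact: ltW.
- move=> e e0; have l1e : (lip_ext_const rho X < (l1 + e)%:E)%E.
    by apply: le_lt_trans el1 _; rewrite lte_fin ltrDl.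
  have [g [gf gl]] := lip_ext_const_extend l1e fL f1.
  exists (g \o sval); split=> [x y|u Au']; last by rewrite /= gf//; exact: fF.
  by apply: (lip_seminorm_le rho_pm gl) => //; exact: cdistE.
exists g; split=> //.
- exact: (gF _ (Pu 0%N isT)).
- exact: (gF _ (Pu 1%N isT)).
- exact: (gF _ (Pu 2%N isT)).
- exact: (gF _ (Pu 3%N isT)).
Qed.

Lemma refinement2_lipschitz (l1 l2 th gamma : R) : 0 < l1 ->
  (lip_ext_const rho X <= l1%:E)%E -> 3 * l1 <= l2 ->
  1 <= th -> pull_const X l1 l2 th -> l2 * th ^+ 2 <= gamma ->
  (forall x, refinement rho l2 (refinement rho l1 F) x !=set0) /\
  (forall x y,
    (hausdorff_dist (refinement rho l2 (refinement rho l1 F) x)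
                    (refinement rho l2 (refinement rho l1 F) y)
     <= gamma%:E * rho x y)%E).
Proof.
move=> l1_gt0 el1 l12 th1 pull gammaE.
have [rho_ge0 rho_xx rho_sym rho_tri] := rho_pm.
have l2_gt0 : 0 < l2 by lra.
have F0 x : F x !=set0 by have [] := F_cvx_cpt x.
pose Fc x0 (u : component (rho := rho) x0) := F (sval u).
have Fc_cvx x0 u : convex_set (@Fc x0 u) by have [] := F_cvx_cpt (sval u).
have Fc_cpt x0 u : compact (@Fc x0 u) by have [] := F_cvx_cpt (sval u).
have sel x0 := component_sel4 (x0 := x0) l1_gt0 el1.
have rho_fin x : (rho x x < +oo)%E by rewrite rho_xx ltry.
pose self x : component (rho := rho) x := exist _ x (rho_fin x).
have E1 x0 (z : component x0) :
    refinement rho l1 F (sval z) = refine1 (@cdist _ _ rho x0) (@Fc x0) l1 z.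
  by rewrite refinement_component.
have F1_0 x : refinement rho l1 F x !=set0.
  rewrite -[x]/(sval (self x)) E1; by apply: refine1_nonempty => //; exact: sel.
have E2 x0 (z : component x0) :
    refinement rho l2 (refinement rho l1 F) (sval z) =
    refine2 (@cdist _ _ rho x0) (@Fc x0) l1 l2 z.
  rewrite refinement_component//; apply/seteqP.
  by split=> v Fv u; have := Fv u; rewrite E1.
split=> [x|x y].
  rewrite -[x]/(sval (self x)) E2; apply: refine2_nonempty => //.
  - exact: cdist_ge0.
  - exact: cdistC.
  - exact: cdist_tri.
  - exact: sel.
have gamma_gt0 : 0 < gamma.
  by apply: lt_le_trans gammaE; rewrite mulr_gt0// exprn_gt0//; lra.
have [xy|] := ltP (rho x y) +oo%E; last first.
  by rewrite leye_eq => /eqP ->; rewrite gt0_muley ?lte_fin// leey.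
pose y' : component x := exist _ y xy.
change ((hausdorff_dist
    (refinement rho l2 (refinement rho l1 F) (sval (self x)))
    (refinement rho l2 (refinement rho l1 F) (sval y'))
  <= gamma%:E * rho (sval (self x)) (sval y'))%E).
rewrite !E2 cdistE// -EFinM.
have lip (a b : component x) : refine2 (@cdist _ _ rho x) (@Fc x) l1 l2 a `<=`
    thicken (refine2 (@cdist _ _ rho x) (@Fc x) l1 l2 b) (gamma * cdist a b).
  have H := refine2_lipschitz dimX (cdist_ge0 rho_pm (x0 := x))
    (cdistC rho_pm (x0 := x)) (cdist_tri rho_pm (x0 := x)) (@Fc_cvx x)
    (@Fc_cpt x) l1_gt0 l12 (sel x) (x := a) b th1 pull.
  apply: subset_trans H _; apply: thickenS => //.
  by apply: ler_wpM2r => //; exact: cdist_ge0.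
apply: hausdorff_dist_le; [|exact: lip|by rewrite cdistC//; exact: lip].
by apply: mulr_ge0; [exact: ltW|exact: cdist_ge0].
Qed.

End Assembly.

Theorem theorem1p9 (R : realType) (M : Type) (rho : M -> M -> \bar R)
  (rho_pm : pseudometric rho)
  (X : completeNormedModType R) (dimX : Vector.axiom 2 X)
  (F : M -> set X)
  (F_cvx_cpt : forall x, [/\ F x !=set0, convex_set (F x) & compact (F x)])
  (F_sel : forall A : set M, (A #<= `I_4)%card ->
    exists f : M -> X, [/\ lipschitz_map rho A f, selection A F f
                         & (lip_seminorm rho A f <= 1)%E]) :
  (forall l1 l2 gamma : R, 0 < l1 ->
     (lip_ext_const rho X <= l1%:E)%E ->
     3 * l1 <= l2 ->
     l2 * (3 * l2 + l1) ^+ 2 / (l2 - l1) ^+ 2 <= gamma ->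
     (forall x, refinement rho l2 (refinement rho l1 F) x !=set0) /\
     (forall x y,
        (hausdorff_dist (refinement rho l2 (refinement rho l1 F) x)
                        (refinement rho l2 (refinement rho l1 F) y)
         <= gamma%:E * rho x y)%E))
  /\
  (euclidean_norm X -> forall l1 l2 gamma : R, 0 < l1 ->
     (lip_ext_const rho X <= l1%:E)%E ->
     3 * l1 <= l2 ->
     l2 * (1 + 2 * l2 / Num.sqrt (l2 ^+ 2 - l1 ^+ 2)) ^+ 2 <= gamma ->
     (forall x, refinement rho l2 (refinement rho l1 F) x !=set0) /\
     (forall x y,
        (hausdorff_dist (refinement rho l2 (refinement rho l1 F) x)
                        (refinement rho l2 (refinement rho l1 F) y)
         <= gamma%:E * rho x y)%E)).
Proof.
split=> [l1 l2 gamma l1_gt0 el1 l12|eucl l1 l2 gamma l1_gt0 el1 l12] gammaE.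
  have l21 : 0 < l2 - l1 by lra.
  apply: (refinement2_lipschitz rho_pm dimX F_cvx_cpt F_sel l1_gt0 el1 l12
    (th := (3 * l2 + l1) / (l2 - l1))).
  - by rewrite ler_pdivlMr// mul1r; lra.
  - by apply: pull_const_normed; lra.
  - by rewrite expr_div_n mulrA.
apply: (refinement2_lipschitz rho_pm dimX F_cvx_cpt F_sel l1_gt0 el1 l12
  (th := 1 + 2 * l2 / Num.sqrt (l2 ^+ 2 - l1 ^+ 2))) => //.
- by rewrite lerDl divr_ge0// ?sqrtr_ge0// mulr_ge0//; lra.
- by apply: pull_const_euclidean => //; lra.
Qed.
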